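(* Let $(\mathfrak{g},\bullet_{\mathfrak{g}},\langle\;,\;\rangle_{\mathfrak{g}})$ be an $\mathrm{R}$-quadratic left Leibniz algebra, $(\mathfrak{h},[\;,\;]_{\mathfrak{h}})$ and $(A,[\;,\;]_A,\langle\;,\;\rangle_A)$ its core. Then $(\mathfrak{g},\bullet_{\mathfrak{g}},\langle\;,\;\rangle_{\mathfrak{g}})$ is isomorphic to $(\mathfrak{h}\oplus A\oplus\mathfrak{h}^*,\bullet,\langle\;,\;\rangle_n)$ where, for $X,Y\in\mathfrak{h}$, $a,b\in A$, $\alpha\in\mathfrak{h}^*$, the non-vanishing products are $$(\ast)\quad\begin{cases}X\bullet Y=\theta(X,Y)+\Omega(Y)^\flat(X),\quad a\bullet b=[a,b]_A+\mu(a,b),\\ X\bullet a=F(X)a+\nu(X,a),\quad X\bullet\alpha=(\mathrm{ad}^{\mathfrak{h}}_X)^*\alpha,\quad a\bullet X=-F(X)a+\rho(a,X),\end{cases}$$ where $F:\mathfrak{h}\to\mathrm{so}(A)\cap\mathrm{Der}(A)$, $\Omega:\mathfrak{h}\to\wedge^2\mathfrak{h}^*$ are linear maps, $\theta,\omega:\mathfrak{h}\times\mathfrak{h}\to A$ are bilinear skew-symmetric, and $\mu,\rho,\nu$ are the $\mathfrak{h}^*$-valued bilinear maps defined by $$(\ast\ast)\quad \nu(X,a)(Y)=\langle\omega(X,Y),a\rangle_A,\quad \mu(a,b)(X)=\langle F(X)a,b\rangle_A,\quad \rho(a,X)(Y)=\langle\theta(X,Y),a\rangle_A.$$ Moreover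 $(F,\omega,\theta,\Omega)$ satisfy, for any $X,Y,Z,T\in\mathfrak{h}$, $$(\ast\ast\ast)\quad\begin{cases} \mathrm{ad}^A_{\omega(X,Y)}=F([X,Y]_{\mathfrak{h}})-[F(X),F(Y)],\\ \mathrm{ad}^A_{\theta(X,Y)}=[F(X),F(Y)],\\ F(X)\theta(Y,Z)+F(Y)\theta(Z,X)+F(Z)\theta(X,Y)=0,\\ F(X)\omega(Y,Z)+F(Y)\omega(Z,X)-F(Z)\theta(X,Y)+\omega(X,[Y,Z]_{\mathfrak{h}})-\omega(Y,[X,Z]_{\mathfrak{h}})=0,\\ F(X)\theta(Y,Z)-F(Y)\omega(Z,X)+F(Z)\theta(X,Y)-\theta(Y,[X,Z]_{\mathfrak{h}})=0,\\ \big((\mathrm{ad}^{\mathfrak{h}}_T)^*\Omega(Z)\big)(X,Y)=\langle\omega(Y,T),\theta(X,Z)\rangle_A+\langle\omega(X,T),\theta(Z,Y)\rangle_A+\langle\theta(Z,T),\theta(X,Y)\rangle_A. \end{cases}$$ Conversely, if $(A,[\;,\;]_A,\langle\;,\;\rangle_A)$ is a quadratic Lie algebra, $(\mathfrak{h},[\;,\;]_{\mathfrak{h}})$ is a Lie algebra and $(F,\omega,\theta,\Omega)$ is a list consisting of linear maps $F:\mathfrak{h}\to\mathrm{so}(A)\cap\mathrm{Der}(A)$, $\Omega:\mathfrak{h}\to\wedge^2\mathfrak{h}^*$ and bilinear skew-symmetric maps $\theta,\omega:\mathfrak{h}\times\mathfrak{h}\to A$, satisfying $(\ast\ast\ast)$,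 with $\mu,\rho,\nu$ defined by $(\ast\ast)$, then $(\mathfrak{h}\oplus A\oplus\mathfrak{h}^*,\bullet,\langle\;,\;\rangle_n)$ with $\bullet$ given by $(\ast)$ is an $\mathrm{R}$-quadratic left Leibniz algebra. It is called the $\mathrm{R}$-quadratic left algebra obtained from $(A,[\;,\;]_A,\langle\;,\;\rangle_A)$ and $(\mathfrak{h},[\;,\;]_{\mathfrak{h}})$ by means of $(F,\omega,\theta,\Omega)$.
   Context: Algebras are real and finite dimensional. $\mathrm{L}_u(v)=u\bullet v$, $\mathrm{R}_u(v)=v\bullet u$. Left Leibniz: $u\bullet(v\bullet w)=(u\bullet v)\bullet w+v\bullet(u\bullet w)$. A metric is a nondegenerate symmetric bilinear form; a left Leibniz algebra with a metric is $\mathrm{R}$-quadratic if every right multiplication is skew-symmetric. A quadratic Lie algebra is a Lie algebra with a metric for which every $\mathrm{ad}_u$ is skew-symmetric. $\mathrm{Leib}(\mathfrak{g})=\mathrm{span}\{u\bullet v+v\bullet u\}$. Isomorphic means by a linear bijection preserving product and metric. Core of an $\mathrm{R}$-quadratic left Leibniz algebra: put $I=\mathrm{Leib}(\mathfrak{g})$, which is a totally isotropic ideal. $A=I^\perp/I$ with product and metric induced from $I^\perp$ is a quadratic Lie algebra $(A,[\;,\;]_A,\langle\;,\;\rangle_A)$. $\mathfrak{h}=\mathfrak{g}/I^\perp$, with projection $\pi_{\mathfrak{h}}:\mathfrak{g}\to\mathfrak{h}$, carries the well-defined Lie bracket $[\pi_{\mathfrak{h}}(u),\pi_{\mathfrak{h}}(v)]_{\mathfrak{h}}=-\pi_{\mathfrak{h}}(\mathrm{L}_v^*u)$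 ($\mathrm{L}_v^*$ the adjoint with respect to the metric). These form the core. Notation: $\mathrm{Der}(A)$ is the space of derivations and $\mathrm{so}(A)$ the space of skew-symmetric endomorphisms of $A$; $\mathrm{ad}^A_a(b)=[a,b]_A$; $[F(X),F(Y)]$ is the commutator; the natural metric is $\langle X+a+\alpha,X+a+\alpha\rangle_n=2\alpha(X)+\langle a,a\rangle_A$; $((\mathrm{ad}^{\mathfrak{h}}_X)^*\alpha)(Y)=-\alpha([X,Y]_{\mathfrak{h}})$ for $\alpha\in\mathfrak{h}^*$; for $\sigma\in\wedge^2\mathfrak{h}^*$, $((\mathrm{ad}^{\mathfrak{h}}_X)^*\sigma)(Y,Z)=-\sigma([X,Y]_{\mathfrak{h}},Z)-\sigma(Y,[X,Z]_{\mathfrak{h}})$ and $\sigma^\flat(X)(Y)=\sigma(X,Y)$. ''Non-vanishing products'' means products of elements of the summands not listed are zero.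
   Formalization: In the converse, h is also assumed 2-step nilpotent, [[X,Y],Z]=0 for all X,Y,Z in h; without it the converse is false (h=so(3), A=0, all data zero), and the condition is necessary for the product (∗) to be left Leibniz. *)

(* Defs.v *)
From HB Require Import structures.
From mathcomp Require Import all_boot all_order all_algebra.
From mathcomp Require Import sesquilinear generic_quotient ring_quotient.
From mathcomp Require Import boolp classical_sets reals.

Set Implicit Arguments.
Unset Strict Implicit.
Unset Printing Implicit Defensive.

Import GRing.Theory.
Local Open Scope ring_scope.
Local Open Scope quotient_scope.

Lemma linfun_linear (K : fieldType) (V W : vectType K) (f : V -> W) :
  linear f -> linfun f =1 f.
Proof.
move=> lf; pose g : {linear V -> W} :=
  HB.pack f (GRing.isLinear.Build _ _ _ _ _ lf).
exact: (lfunE g).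
Qed.

(* The additive quotient of ring_quotient, with its vector space structure. *)
Section QuotientSpace.
Variables (K : fieldType) (V : vectType K) (U : {vspace V}).

Definition quotv := Quotient.quot (U : zmodClosed V).

HB.instance Definition _ := GRing.Zmodule.on quotv.

Definition piv (x : V) : quotv := \pi x.
Definition rpv (q : quotv) : V := repr q.

Lemma rpvK q : piv (rpv q) = q.
Proof. exact: reprK. Qed.

Lemma piv_eq x y : (piv x == piv y) = (x - y \in U).
Proof. by rewrite /piv -Quotient.idealrBE. Qed.

Lemma pivP x y : piv x = piv y <-> x - y \in U.
Proof. by rewrite -piv_eq; split=> [->//|/eqP]. Qed.

Fact piv_is_zmod_morphism : zmod_morphism piv.
Proof. exact: (@pi_is_zmod_morphism _ _ _ (Quotient.quot (U : zmodClosed V))). Qed.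

Lemma rpv_piv x : rpv (piv x) - x \in U.
Proof. by rewrite -piv_eq rpvK. Qed.

Definition scalev (a : K) (q : quotv) : quotv := piv (a *: rpv q).

Fact piv_scale a x : piv (a *: x) = scalev a (piv x).
Proof.
by apply/pivP; rewrite -scalerBr rpredZ // -memvN opprB rpv_piv.
Qed.

Let pivD x y : piv (x + y) = piv x + piv y.
Proof.
have pivB := piv_is_zmod_morphism.
have piv0 : piv 0 = 0 by rewrite -(subrr 0) pivB subrr.
have pivN z : piv (- z) = - piv z by rewrite -sub0r pivB piv0 sub0r.
by rewrite -{1}(opprK y) pivB pivN opprK.
Qed.

Fact scalevA a b q : scalev a (scalev b q) = scalev (a * b) q.
Proof. by rewrite -(rpvK q) -!piv_scale scalerA. Qed.
Fact scale1v : left_id 1 scalev.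
Proof. by move=> q; rewrite -(rpvK q) -piv_scale scale1r. Qed.
Fact scalevDr : right_distributive scalev +%R.
Proof.
by move=> a p q; rewrite -(rpvK p) -(rpvK q) -pivD -!piv_scale -pivD scalerDr.
Qed.
Fact scalevDl q : {morph scalev^~ q : a b / a + b}.
Proof. by move=> a b; rewrite -(rpvK q) -!piv_scale -pivD scalerDl. Qed.

HB.instance Definition _ := GRing.Zmodule_isLmodule.Build K quotv
  scalevA scale1v scalevDr scalevDl.

Fact piv_is_linear : linear piv.
Proof. by move=> a x y; rewrite pivD piv_scale. Qed.
HB.instance Definition _ := GRing.isLinear.Build K V quotv _ piv piv_is_linear.

Fact quotv_vect_iso : Vector.axiom (\dim (U^C)%VS) quotv.
Proof.
pose p := daddv_pi U^C U.
have UC0 : (U^C :&: U = 0)%VS by rewrite capvC capv_compl.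
have padd x : p x + daddv_pi U U^C x = x.
  by apply: daddv_pi_add; rewrite // addvC addv_complf memvf.
have pU x : x \in U -> p x = 0.
  move=> Ux; have := padd x; rewrite [daddv_pi U _ _]daddv_pi_id ?capv_compl //.
  by move/(canRL (addrK _)); rewrite subrr.
have pB x : p x - x \in U.
  by rewrite -{2}(padd x) opprD addNKr memvN memv_pi.
pose f (q : quotv) := \row_i coord (vbasis U^C) i (p (rpv q)).
have fpi x : f (piv x) = \row_i coord (vbasis U^C) i (p x).
  apply/rowP => i; rewrite !mxE; congr (coord _ _ _).
  by have /pU := rpv_piv x; rewrite linearB => /subr0_eq.
exists f.
  move=> a x y; rewrite -(rpvK x) -(rpvK y) -linearP !fpi.
  by apply/rowP => i; rewrite !mxE !linearP.
exists (fun r : 'rV_(\dim U^C) => piv (\sum_i r 0 i *: (vbasis U^C)`_i)).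
  move=> q; rewrite -(rpvK q) fpi; apply/pivP.
  under eq_bigr do rewrite mxE.
  by rewrite -(coord_vbasis (memv_pi _ _ _)) pB.
move=> r; rewrite fpi daddv_pi_id //.
  apply/rowP=> i; rewrite mxE.
  by rewrite coord_sum_free ?(basis_free (vbasisP _)).
by apply: rpred_sum => j _; rewrite rpredZ ?vbasis_mem ?memt_nth.
Qed.
HB.instance Definition _ := Lmodule_hasFinDim.Build K quotv quotv_vect_iso.

End QuotientSpace.

Section Algebras.
Variables (R : realType) (V : vectType R).
Implicit Types (mul br : V -> V -> V) (fm : {symmetric V}).

Definition bilinear_product mul :=
  (forall v, linear (mul^~ v)) /\ (forall u, linear (mul u)).

Definition left_leibniz mul := bilinear_product mul /\
  forall u v w, mul u (mul v w) = mul (mul u v) w + mul v (mul u w).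

Definition lie_algebra br := [/\ bilinear_product br,
  forall x, br x x = 0 &
  forall x y z, br x (br y z) + br y (br z x) + br z (br x y) = 0].

Definition skew_endo fm (f : V -> V) :=
  forall x y, fm (f x) y = - fm x (f y).

Definition derivation br (f : V -> V) :=
  forall x y, f (br x y) = br (f x) y + br x (f y).

Definition R_quadratic mul fm := [/\ left_leibniz mul, nondegenerate fm &
  forall u, skew_endo fm (mul^~ u)].

Definition quadratic_lie br fm := [/\ lie_algebra br, nondegenerate fm &
  forall u, skew_endo fm (br u)].

Definition smallest_vspace (S : set V) (U : {vspace V}) :=
  (forall x, S x -> x \in U) /\
  (forall W : {vspace V}, (forall x, S x -> x \in W) -> (U <= W)%VS).

(* The default values of xget here and in adjoint are never reached: see      *)
(* span_setP and adjointP.                                                    *)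
Definition span_set (S : set V) : {vspace V} := xget 0%VS (smallest_vspace S).

Definition Leib mul : {vspace V} :=
  span_set [set x | exists u v, x = mul u v + mul v u].

Definition adjoint fm (f : V -> V) : 'End(V) :=
  xget 0 [set g : 'End(V) | forall u v, fm (f u) v = fm u (g v)].

Lemma span_setP S : smallest_vspace S (span_set S).
Proof.
apply: (@xgetPex _ 0%VS (smallest_vspace S)).
pose P n := `[< exists2 W : {vspace V}, (forall x, S x -> x \in W) & \dim W = n >].
have exP : exists n, P n.
  by exists (\dim {:V}); apply/asboolP; exists fullv => // x _; exact: memvf.
case: (ex_minnP exP) => n /asboolP[U SU dU] minU; exists U; split=> // W SW.
have SUW x : S x -> x \in (U :&: W)%VS by move=> Sx; rewrite memv_cap SU ?SW.
have le : (\dim U <= \dim (U :&: W))%N.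
  by rewrite dU; apply/minU/asboolP; exists (U :&: W)%VS.
by have := eqEdim (U :&: W) U; rewrite capvSl le => /eqP <-; exact: capvSr.
Qed.

Lemma adjointP fm (f : V -> V) : nondegenerate fm -> linear f ->
  forall u v, fm (f u) v = fm u (adjoint fm f v).
Proof.
move=> ndf lf.
have row_lin v : linear (fun u => fm u v : R^o).
  by move=> a x y; rewrite linearPl.
have comp_lin v : linear (fun u => fm (f u) v : R^o).
  by move=> a x y; rewrite lf linearPl.
pose flat v : 'Hom(V, R^o) := linfun (fun u => fm u v : R^o).
pose pre v : 'Hom(V, R^o) := linfun (fun u => fm (f u) v : R^o).
have flat_lin : linear flat.
  move=> a x y; apply/lfunP => u.
  by rewrite add_lfunE scale_lfunE !linfun_linear // linearPr.
have pre_lin : linear pre.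
  move=> a x y; apply/lfunP => u.
  by rewrite add_lfunE scale_lfunE !linfun_linear // linearPr.
have kerF : lker (linfun flat) == 0%VS.
  rewrite -subv0; apply/subvP => v; rewrite memv_ker linfun_linear // => /eqP v0.
  rewrite -(eqP ndf); apply/mem_orthovP => u _.
  have := congr1 (fun g : 'Hom(V, R^o) => g u) v0.
  by rewrite /= zero_lfunE linfun_linear // => e; apply/eqP; rewrite herm_eq0C e.
have imF : limg (linfun flat) = fullv.
  apply/eqP; rewrite eqEdim subvf /=.
  have := limg_ker_dim (linfun flat) fullv.
  rewrite (eqP kerF) capv0 dimv0 add0n => ->.
  by rewrite !dimvf /dim /= muln1.
apply: (@xgetPex _ 0 [set g : 'End(V) | forall u v, fm (f u) v = fm u (g v)]).
exists ((linfun flat)^-1 \o linfun pre)%VF => u v.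
have e : linfun flat (((linfun flat)^-1 \o linfun pre)%VF v) = pre v.
  by rewrite comp_lfunE limg_lfunVK ?imF ?memvf // linfun_linear.
move: (_ v) e => x; rewrite linfun_linear //.
move/(congr1 (fun g : 'Hom(V, R^o) => g u)).
by rewrite /flat /pre !linfun_linear // => ->.
Qed.

End Algebras.

Definition isomorphic (R : realType) (V W : vectType R)
    (mulV : V -> V -> V) (fmV : {symmetric V})
    (mulW : W -> W -> W) (fmW : {symmetric W}) :=
  exists f : 'Hom(V, W), [/\ bijective f,
    forall u v, f (mulV u v) = mulW (f u) (f v) &
    isometry fmW fmV f].

Section Core.
Variables (R : realType) (V : vectType R).
Variables (mul : V -> V -> V) (fm : {symmetric V}).

Definition Leib_perp : {vspace V} := orthov fm (Leib mul).

(* Leib mul is contained in Leib_perp (Leib_sub_perp), so its preimage in the *)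
(* subspace type is Leib mul itself.                                          *)
Definition coreA : vectType R :=
  quotv (linfun (@vsval R V Leib_perp) @^-1: Leib mul)%VS.

(* Brackets and metric of the core are computed on representatives; see       *)
(* coreA_bracketE, coreA_metricE and coreH_bracketE for independence of the   *)
(* choice when (mul, fm) is R-quadratic.                                      *)
Definition coreA_bracket (p q : coreA) : coreA :=
  piv _ (vsproj Leib_perp (mul (vsval (rpv p)) (vsval (rpv q)))).

Definition coreA_metric (p q : coreA) : R := fm (vsval (rpv p)) (vsval (rpv q)).

Definition coreH : vectType R := quotv Leib_perp.

Definition coreH_bracket (p q : coreH) : coreH :=
  - piv _ (adjoint fm (mul (rpv q)) (rpv p)).

Lemma fmC u v : fm u v = fm v u.
Proof. by rewrite [LHS]hermC expr0 mul1r. Qed.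

Lemma perpP (U : {vspace V}) w :
  (w \in orthov fm U) <-> (forall i, i \in U -> fm i w = 0).
Proof.
split=> [/mem_orthovP h i iU|h]; first by rewrite fmC; apply: h.
by apply/mem_orthovP => i iU; rewrite [LHS]fmC; apply: h.
Qed.

Lemma coreA_metricE (u v : subvs_of Leib_perp) :
  coreA_metric (piv _ u) (piv _ v) = fm (vsval u) (vsval v).
Proof.
pose J := (linfun (@vsval R V Leib_perp) @^-1: Leib mul)%VS.
have repI x : vsval (rpv (piv J x)) - vsval x \in Leib mul.
  by have := rpv_piv J x; rewrite -memv_preim lfunE.
have perp0 x (y : subvs_of Leib_perp) : x \in Leib mul -> fm x (vsval y) = 0.
  by move=> xI; rewrite fmC; have /mem_orthovP := subvsP y; apply.
have split4 (a b c d : V) : fm a b - fm c d = fm (a - c) b + fm (b - d) c.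
  rewrite (fmC (b - d)) linearBl linearBr.
  by rewrite addrA subrK.
by apply/eqP; rewrite -subr_eq0 split4 !perp0 ?repI ?addr0.
Qed.

Fact coreA_metricC p q : coreA_metric p q = (-1) ^+ false * idfun (coreA_metric q p).
Proof. by rewrite expr0 mul1r; apply: fmC. Qed.

Fact coreA_metric_bilinear :
  bilinear_for *%R (idfun \; *%R) coreA_metric.
Proof.
have l a p q r : coreA_metric (a *: p + q) r = a * coreA_metric p r + coreA_metric q r.
  rewrite -(rpvK p) -(rpvK q) -(rpvK r) -linearP !coreA_metricE /=.
  by rewrite linearPl.
split=> [r a p q|r a p q]; first exact: l.
by rewrite /= coreA_metricC l expr0 mul1r /= [coreA_metric r p]fmC [coreA_metric r q]fmC.
Qed.
HB.instance Definition _ := bilinear_isBilinear.Build R coreA coreA R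
  *%R (idfun \; *%R) coreA_metric coreA_metric_bilinear.
HB.instance Definition _ := isHermitianSesquilinear.Build R coreA false idfun
  coreA_metric coreA_metricC.

Hypothesis mulP : R_quadratic mul fm.

Let mul_linl v : linear (mul^~ v). Proof. by case: mulP => -[[]]. Qed.
Let mul_linr u : linear (mul u). Proof. by case: mulP => -[[]]. Qed.
Let leib u v w : mul u (mul v w) = mul (mul u v) w + mul v (mul u w).
Proof. by case: mulP => -[_]. Qed.
Let Rskew u x y : fm (mul x u) y = - fm x (mul y u).
Proof. by case: mulP => _ _; apply. Qed.
Let ndfm : nondegenerate fm. Proof. by case: mulP. Qed.
Let mulDl u v w : mul (u + v) w = mul u w + mul v w.
Proof. by have := mul_linl w 1 u v; rewrite !scale1r. Qed.
Let mulBl u v w : mul (u - v) w = mul u w - mul v w.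
Proof. by have := mul_linl w (-1) v u; rewrite !scaleN1r ![- _ + _]addrC. Qed.
Let mulBr u v w : mul u (v - w) = mul u v - mul u w.
Proof. by have := mul_linr u (-1) w v; rewrite !scaleN1r ![- _ + _]addrC. Qed.

Lemma Leib_gen u v : mul u v + mul v u \in Leib mul.
Proof. by have [+ _] := span_setP [set x | exists u v, x = mul u v + mul v u]; apply; exists u, v. Qed.

Lemma Leib_sub (W : {vspace V}) :
  (forall u v, mul u v + mul v u \in W) -> (Leib mul <= W)%VS.
Proof.
move=> genW; have [_] := span_setP [set x | exists u v, x = mul u v + mul v u].
by apply=> x [u [v ->]].
Qed.

Lemma Leib_mul0 i w : i \in Leib mul -> mul i w = 0.
Proof.
move=> iI; suff /subvP/(_ i iI) : (Leib mul <= lker (linfun (mul^~ w)))%VS.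
  by rewrite memv_ker linfun_linear // => /eqP.
apply: Leib_sub => u v; rewrite memv_ker linfun_linear //; apply/eqP.
have := leib u v w; rewrite [in X in _ = _ + X]leib.
move=> e; rewrite mulDl.
move: e; rewrite addrA addrC -[LHS]addr0 => /addrI /esym.
by [].
Qed.

Lemma Leib_perpP w :
  (w \in Leib_perp) <-> (forall x y, fm (mul w x) y = - fm x (mul w y)).
Proof.
have key x y : fm (mul x y + mul y x) w = - (fm x (mul w y) + fm (mul w x) y).
  rewrite [LHS]linearDl [X in X + _](Rskew y x) [X in _ + X](Rskew x y) opprD.
  by rewrite (fmC y) addrC.
split=> [/perpP wI x y|wsk].
  have := wI _ (Leib_gen x y); rewrite key => /eqP.
  by rewrite oppr_eq0 addrC addr_eq0 => /eqP.
have /subvP sub : (Leib mul <= orthov fm <[w]>)%VS.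
  apply: Leib_sub => x y; rewrite mem_orthov1; apply/eqP.
  by apply: etrans (key x y) _; rewrite wsk addrN oppr0.
apply/perpP => i /sub/perpP h; rewrite fmC; apply: h.
exact: memv_line.
Qed.

Lemma Leib_sub_perp : (Leib mul <= Leib_perp)%VS.
Proof.
apply/subvP => i iI; apply/Leib_perpP => x y.
by rewrite !Leib_mul0 // linear0l linear0r oppr0.
Qed.

Lemma Leib_mulr v i : i \in Leib mul -> mul v i \in Leib mul.
Proof.
by move=> iI; rewrite -[mul v i]addr0 -(Leib_mul0 v iI) Leib_gen.
Qed.

Lemma mul_perp u v : mul u v \in Leib_perp.
Proof.
by apply/perpP => i iI; rewrite fmC Rskew Leib_mul0 // linear0r oppr0.
Qed.

Lemma coreA_bracketE (u v : subvs_of Leib_perp) :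
  coreA_bracket (piv _ u) (piv _ v) =
  piv _ (vsproj Leib_perp (mul (vsval u) (vsval v))).
Proof.
pose J := (linfun (@vsval R V Leib_perp) @^-1: Leib mul)%VS.
have repI x : vsval (rpv (piv J x)) - vsval x \in Leib mul.
  by have := rpv_piv J x; rewrite -memv_preim lfunE.
apply/pivP; rewrite -memv_preim lfunE /= !vsprojK ?mul_perp //.
rewrite -[X in X - _](subrK (mul (vsval u) (vsval (rpv (piv J v))))).
rewrite -addrA -mulBr -mulBl (Leib_mul0 _ (repI u)) add0r.
exact/Leib_mulr/repI.
Qed.

Lemma coreH_bracketE u v :
  coreH_bracket (piv _ u) (piv _ v) = - piv _ (adjoint fm (mul v) u).
Proof.
congr (- _); apply/pivP/perpP => i iI.
have fmBr a b c : fm a (b - c) = fm a b - fm a c by exact: linearBr.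
rewrite fmBr -!adjointP //.
set v' := rpv (piv _ v); set u' := rpv (piv _ u).
have mulI w : mul w i \in Leib mul by apply: Leib_mulr.
have /perpP du : u' - u \in Leib_perp by exact: (rpv_piv Leib_perp u).
have /perpP dv : v' - v \in Leib_perp by exact: (rpv_piv Leib_perp v).
have -> : mul v' i = mul v i.
  apply/eqP; rewrite -subr_eq0 -mulBl -memv0 -(eqP ndfm).
  by apply/perpP => z _; rewrite fmC Rskew fmC dv ?oppr0 // Leib_mulr.
by rewrite -fmBr du.
Qed.

Lemma coreH_two_step p q r : coreH_bracket (coreH_bracket p q) r = 0.
Proof.
rewrite -(rpvK p) -(rpvK q) -(rpvK r).
move: (rpv p) (rpv q) (rpv r) => x y z.
rewrite (coreH_bracketE x y) -[- piv _ _]linearN coreH_bracketE.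
rewrite -linearN -(linear0 (piv Leib_perp)); apply/pivP; rewrite subr0 memvN.
have fmNr a b : fm a (- b) = - fm a b by exact: linearNr.
apply/perpP => i iI; rewrite -adjointP // fmNr -adjointP //.
have comm a b : mul a (mul b i) = mul b (mul a i).
  rewrite leib -[RHS]add0r; congr (_ + _).
  apply/eqP; rewrite -memv0 -(eqP ndfm); apply/perpP => t _.
  have /perpP h := mul_perp a b.
  by rewrite fmC Rskew fmC h ?oppr0 // Leib_mulr.
have sk a b c : fm a (mul b (mul c i)) = - fm b (mul a (mul c i)).
  by rewrite fmC Rskew.
apply/eqP; rewrite oppr_eq0 fmC; apply/eqP.
have : fm x (mul y (mul z i)) = - fm x (mul y (mul z i)).
  by rewrite [LHS]sk comm sk opprK comm sk comm.
by move/eqP; rewrite -addr_eq0 -mulr2n Num.Theory.mulrn_eq0 /= => /eqP.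
Qed.

End Core.

Arguments Leib_perp {R V} mul fm.
Arguments coreA {R V} mul fm.
Arguments coreA_bracket {R V} mul fm p q.
Arguments coreA_metric {R V} mul fm p q.
Arguments coreH {R V} mul fm.
Arguments coreH_bracket {R V} mul fm p q.

Section DirectSum.
Variables (R : realType) (h A : vectType R).
Variables (brh : h -> h -> h) (brA : A -> A -> A) (fmA : {symmetric A}).

Definition dual : vectType R := 'Hom(h, R^o).

Definition dsum : vectType R := (h * A * dual)%type.

Definition natural_metric (u v : dsum) : R :=
  u.2 v.1.1 + v.2 u.1.1 + fmA u.1.2 v.1.2.

Fact natural_metricC u v :
  natural_metric u v = (-1) ^+ false * idfun (natural_metric v u).
Proof.
rewrite expr0 mul1r /natural_metric /= [u.2 _ + _]addrC; congr (_ + _).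
exact: fmC.
Qed.

Fact natural_metric_bilinear :
  bilinear_for *%R (idfun \; *%R) natural_metric.
Proof.
have e (a x x' y y' z z' : R) : (a * x + x') + (a * y + y') + (a * z + z') =
    a * (x + y + z) + (x' + y' + z').
  by rewrite !mulrDr (addrACA (a * x)) (addrACA (a * x + a * y)).
have l a u v w :
    natural_metric (a *: u + v) w = a * natural_metric u w + natural_metric v w.
  rewrite -[RHS]e /natural_metric /= add_lfunE scale_lfunE.
  by rewrite [w.2 _]linearP [X in _ + X = _]linearPl.
have c u v : natural_metric u v = natural_metric v u.
  by rewrite natural_metricC expr0 mul1r.
by split=> [w a u v|w a u v]; rewrite ?l //= !(c w) l.
Qed.
HB.instance Definition _ := bilinear_isBilinear.Build R dsum dsum R
  *%R (idfun \; *%R) natural_metric natural_metric_bilinear.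
HB.instance Definition _ := isHermitianSesquilinear.Build R dsum false idfun
  natural_metric natural_metricC.

Lemma natural_metric_diag X a alpha :
  natural_metric (X, a, alpha) (X, a, alpha) = 2 * alpha X + fmA a a.
Proof. by rewrite /natural_metric /= mulr_natl mulr2n. Qed.

Definition coad (X : h) (alpha : dual) : dual :=
  linfun (fun Y => - alpha (brh X Y) : R^o).

(* A bilinear form s on h is given by the linear map s^flat : h -> dual. *)
Definition coad2 (X : h) (s : 'Hom(h, dual)) (Y Z : h) : R :=
  - s (brh X Y) Z - s Y (brh X Z).

Variables (F : 'Hom(h, 'End(A))) (omega theta : 'Hom(h, 'Hom(h, A))).
Variable Omega : 'Hom(h, 'Hom(h, dual)).

(* F takes values in so(A) :&: Der(A), omega and theta are skew-symmetric, and *)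
(* Omega takes values in the alternating forms.                                *)
Definition leibniz_data :=
  [/\ forall X, skew_endo fmA (F X) /\ derivation brA (F X),
      forall X Y, omega X Y = - omega Y X,
      forall X Y, theta X Y = - theta Y X &
      forall X Y Z, Omega X Y Z = - Omega X Z Y].

Definition nu (X : h) (a : A) : dual :=
  linfun (fun Y => fmA (omega X Y) a : R^o).
Definition mu (a b : A) : dual := linfun (fun X => fmA (F X a) b : R^o).
Definition rho (a : A) (X : h) : dual :=
  linfun (fun Y => fmA (theta X Y) a : R^o).

(* Expansion by bilinearity of the products of the summands. *)
Definition dsum_product (u v : dsum) : dsum :=
  let: (X, a, _) := u in let: (Y, b, beta) := v in
  (0, theta X Y + brA a b + F X b - F Y a,
   Omega Y X + mu a b + nu X b + coad X beta + rho a Y).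

Definition structure_equations :=
  [/\ forall X Y a, brA (omega X Y) a = F (brh X Y) a - (F X (F Y a) - F Y (F X a)),
      forall X Y a, brA (theta X Y) a = F X (F Y a) - F Y (F X a),
      forall X Y Z, F X (theta Y Z) + F Y (theta Z X) + F Z (theta X Y) = 0 &
   [/\ forall X Y Z, F X (omega Y Z) + F Y (omega Z X) - F Z (theta X Y)
         + omega X (brh Y Z) - omega Y (brh X Z) = 0,
       forall X Y Z, F X (theta Y Z) - F Y (omega Z X) + F Z (theta X Y)
         - theta Y (brh X Z) = 0 &
       forall X Y Z T, coad2 T (Omega Z) X Y =
         fmA (omega Y T) (theta X Z) + fmA (omega X T) (theta Z Y)
         + fmA (theta Z T) (theta X Y)]].

(* The left Leibniz identity at (X, Y, alpha), alpha in dual, forces ad_X and *)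
(* ad_Y to commute. No combination of structure_equations yields this (take   *)
(* A = 0 and Omega = 0), so it has to be assumed to get a Leibniz algebra     *)
(* back from the data; see two_step_necessary. The bracket of a core always   *)
(* satisfies it; see coreH_two_step.                                          *)
Definition two_step := forall X Y Z, brh (brh X Y) Z = 0.

Lemma two_step_necessary : lie_algebra brh -> bilinear_product brA ->
  left_leibniz dsum_product -> two_step.
Proof.
move=> [[brh_l brh_r] brh_alt brh_jac] [brA_l brA_r] [_ leib].
pose lhl Y : {linear h -> h} :=
  HB.pack (brh^~ Y) (GRing.isLinear.Build _ _ _ _ _ (brh_l Y)).
pose lhr X : {linear h -> h} :=
  HB.pack (brh X) (GRing.isLinear.Build _ _ _ _ _ (brh_r X)).
pose lAr a : {linear A -> A} :=
  HB.pack (brA a) (GRing.isLinear.Build _ _ _ _ _ (brA_r a)).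
have brhN X Y : brh X Y = - brh Y X.
  apply/eqP; rewrite -addr_eq0; have := brh_alt (X + Y).
  rewrite -[brh _ _]/(lhl _ _) linearD /= -![brh _ (X + Y)]/(lhr _ _) !linearD /=.
  by rewrite !brh_alt add0r addr0 => ->.
have coadE X al Y : coad X al Y = - al (brh X Y).
  by rewrite linfun_linear // => c x y; rewrite brh_r linearP opprD scalerN.
have brA0 a : brA a 0 = 0 by exact: (linear0 (lAr a)).
have fm0 a : fmA a 0 = 0 by exact: linear0r.
have fm0l a : fmA 0 a = 0 by exact: linear0l.
have mu0 a : mu a 0 = 0.
  apply/lfunP => Y; rewrite linfun_linear ?fm0 ?zero_lfunE //.
  by move=> c x y; rewrite !fm0 scaler0 addr0.
have nu0 X : nu X 0 = 0.
  apply/lfunP => Y; rewrite linfun_linear ?fm0 ?zero_lfunE //.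
  by move=> c x y; rewrite !fm0 scaler0 addr0.
have rho0 a : rho a 0 = 0.
  have e Y : fmA (theta 0 Y) a = 0 by rewrite linear0 zero_lfunE fm0l.
  apply/lfunP => Y; rewrite linfun_linear ?e ?zero_lfunE //.
  by move=> c x y; rewrite !e scaler0 addr0.
have coad0 al : coad 0 al = 0.
  apply/lfunP => Y; rewrite coadE zero_lfunE.
  by rewrite -[brh _ _]/(lhl _ _) linear0 linear0 oppr0.
have pE X a al be : dsum_product (X, a, al) (0, 0, be) = (0, 0, coad X be).
  rewrite /= brA0 !linear0 !zero_lfunE mu0 nu0 rho0.
  by rewrite subr0 !addr0 !add0r.
have comm X Y al : coad X (coad Y al) = coad Y (coad X al).
  have := leib (X, 0, 0) (Y, 0, 0) (0, 0, al).
  rewrite !pE.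
  move/(congr1 snd) => /= ->.
  by rewrite coad0 add0r.
have sep (v : h) : (forall al : dual, al v = 0) -> v = 0.
  move=> v0; rewrite (coord_vbasis (memvf v)); apply: big1 => i _.
  have := v0 (linfun (coord (vbasis fullv) i : h -> R^o)).
  by rewrite lfunE /= => ->; rewrite scale0r.
have key X Y Z : brh X (brh Y Z) = brh Y (brh X Z).
  apply/subr0_eq/sep => al; rewrite linearB /=.
  have /(congr1 (fun g : dual => g Z)) := comm Y X al.
  by rewrite !coadE !opprK => ->; rewrite subrr.
move=> X Y Z; have := brh_jac X Y Z.
rewrite (brhN Z X) -[brh Y (- _)]/(lhr Y _) linearN /= key subrr add0r.
by rewrite brhN => /eqP; rewrite oppr_eq0 => /eqP.
Qed.

End DirectSum.

Arguments natural_metric {R h A} fmA u v.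
Arguments dsum_product {R h A} brh brA fmA F omega theta Omega u v.
Arguments leibniz_data {R h A} brA fmA F omega theta Omega.
Arguments structure_equations {R h A} brh brA fmA F omega theta Omega.

(* Main.v *)
From HB Require Import structures.
Require Import Defs.
From mathcomp Require Import all_boot all_order all_algebra.
From mathcomp Require Import sesquilinear reals.
From mathcomp Require Import ring lra.

(** Write I for Leib(g) and Q for its orthogonal.  I is a totally isotropic
ideal with i . w = 0 for i in I, and every product lies in Q.  A section r of
Q -> A = Q/I and an isotropic section s of g -> h = g/Q orthogonal to r (a
Witt decomposition, adapted_sections) give a linear isometry

  h + A + h^* -> g,   (X, a, alpha) |-> s(X) + r(a) + d(alpha),

where d identifies h^* with I through the metric.  The components of the
products s(X) . r(a) and s(X) . s(Y) define F, omega, theta and Omega.  Since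
u . v + v . u lies in I and right multiplications are skew, these components and
the brackets of A and h determine all products, and the product read on
h + A + h^* has the announced shape (assemble_product).

There is one sign to watch.  With the bracket [pi u, pi v] = - pi (L_v^* u)
one has < s(X) . i, s(T) > = < i, s([X, T]) > when s is a section of pi,
whereas the model asks for the coadjoint action, - alpha([X, T]).  So s is
taken to be a section of - pi, and d such that < d(alpha), u > =
- alpha(pi u): changing the sign of the identification turns the bracket of h
into its opposite.

What remains is the algebra of the model h + A + h^*, in the form of an
equivalence (R_quadratic_dsumP): for A a quadratic Lie algebra and h a Lie
algebra, the model is an R-quadratic left Leibniz algebra if and only if
F takes values in skew derivations, omega, theta and the values of Omega are
skew, the structure equations hold, and h is two-step nilpotent.  Skewness of
the right multiplications amounts to that of the four data (dsum_skewE).  The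
Leibniz identity is trilinear and has an A-component and an h^*-component, so
it splits into one identity for each choice of a summand for each of the three
factors.  Using skewness to move F and the bracket of A across the metric,
these identities become the Jacobi identity of A, the derivation rule for F,
the structure equations, and the commutation of ad_X and ad_Y on h.

The converse half of the theorem is one direction of this equivalence.  The
direct half is the other one, applied to the model: the isometry above makes
it isomorphic to g, hence R-quadratic. *)

Set Implicit Arguments.
Unset Strict Implicit.
Unset Printing Implicit Defensive.

Import GRing.Theory.
Local Open Scope ring_scope.

(** * Symmetric forms, bilinear products and duals *)

Section SymmetricForm.
Variables (R : realType) (V : vectType R) (fm : {symmetric V}).

Lemma formDl u v w : fm (u + v) w = fm u w + fm v w.
Proof. exact: linearDl. Qed.
Lemma formNl u w : fm (- u) w = - fm u w.
Proof. exact: linearNl. Qed.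
Lemma formZl c u w : fm (c *: u) w = c * fm u w.
Proof. by rewrite linearZl_LR. Qed.
Lemma form0l w : fm 0 w = 0.
Proof. exact: linear0l. Qed.
Lemma formDr u v w : fm u (v + w) = fm u v + fm u w.
Proof. exact: linearDr. Qed.
Lemma formNr u w : fm u (- w) = - fm u w.
Proof. exact: linearNr. Qed.
Lemma formZr c u w : fm u (c *: w) = c * fm u w.
Proof. by rewrite linearZr_LR. Qed.
Lemma form0r w : fm w 0 = 0.
Proof. exact: linear0r. Qed.
Definition formE := (formDl, formNl, formZl, form0l, formDr, formNr, formZr, form0r).

Lemma nondegenerateP :
  nondegenerate fm <-> (forall u, (forall v, fm u v = 0) -> u = 0).
Proof.
split=> [nd u u0|sep].
  apply/eqP; rewrite -memv0 -(eqP nd); apply/mem_orthovP => v _; exact: u0.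
apply/eqP/vspaceP => u; rewrite memv0; apply/idP/eqP => [/mem_orthovP u0|->].
  by apply: sep => v; apply: u0; apply: memvf.
exact: mem0v.
Qed.

Lemma form_inj : nondegenerate fm ->
  forall u v, (forall w, fm u w = fm v w) -> u = v.
Proof.
move=> /nondegenerateP nd u v uv; apply/subr0_eq/nd => w.
by rewrite !formE uv subrr.
Qed.

End SymmetricForm.

Section BilinearProduct.
Variables (R : realType) (V : vectType R) (mul : V -> V -> V).
Hypothesis mulP : bilinear_product mul.

Lemma bprodPl c u v w : mul (c *: u + v) w = c *: mul u w + mul v w.
Proof. by case: mulP => + _; apply. Qed.
Lemma bprodPr c u v w : mul w (c *: u + v) = c *: mul w u + mul w v.
Proof. by case: mulP => _; apply. Qed.
Lemma bprodDl u v w : mul (u + v) w = mul u w + mul v w.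
Proof. by have := bprodPl 1 u v w; rewrite !scale1r. Qed.
Lemma bprodDr u v w : mul w (u + v) = mul w u + mul w v.
Proof. by have := bprodPr 1 u v w; rewrite !scale1r. Qed.
Lemma bprod0l w : mul 0 w = 0.
Proof. by apply: (addrI (mul 0 w)); rewrite -bprodDl !addr0. Qed.
Lemma bprod0r w : mul w 0 = 0.
Proof. by apply: (addrI (mul w 0)); rewrite -bprodDr !addr0. Qed.
Lemma bprodZl c u w : mul (c *: u) w = c *: mul u w.
Proof. by have := bprodPl c u 0 w; rewrite bprod0l !addr0. Qed.
Lemma bprodZr c u w : mul w (c *: u) = c *: mul w u.
Proof. by have := bprodPr c u 0 w; rewrite bprod0r !addr0. Qed.
Lemma bprodNl u w : mul (- u) w = - mul u w.
Proof. by rewrite -scaleN1r bprodZl scaleN1r. Qed.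
Lemma bprodNr u w : mul w (- u) = - mul w u.
Proof. by rewrite -scaleN1r bprodZr scaleN1r. Qed.
Definition bprodE := (bprodDl, bprodNl, bprodZl, bprod0l,
  bprodDr, bprodNr, bprodZr, bprod0r).

End BilinearProduct.

Lemma lie_skew (R : realType) (V : vectType R) (br : V -> V -> V) :
  lie_algebra br -> forall x y, br x y = - br y x.
Proof.
move=> [brP alt _] x y; apply/eqP; rewrite -addr_eq0.
by have := alt (x + y); rewrite !(bprodE brP) !alt add0r addr0 => ->.
Qed.

Lemma dual_separates (R : realType) (V : vectType R) (v : V) :
  (forall al : dual V, al v = 0) -> v = 0.
Proof.
move=> v0; rewrite (coord_vbasis (memvf v)); apply: big1 => i _.
have := v0 (linfun (coord (vbasis fullv) i : V -> R^o)).
by rewrite lfunE /= => ->; rewrite scale0r.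
Qed.

Lemma dualN (R : realType) (V : vectType R) (al : dual V) v : al (- v) = - al v.
Proof. exact: linearN. Qed.

(** * The algebra h + A + h^* *)

Section DirectSum.
Variables (R : realType) (h A : vectType R).
Variables (brh : h -> h -> h) (brA : A -> A -> A) (fmA : {symmetric A}).
Variables (F : 'Hom(h, 'End(A))) (omega theta : 'Hom(h, 'Hom(h, A))).
Variable Omega : 'Hom(h, 'Hom(h, dual h)).
Hypotheses (quadA : quadratic_lie brA fmA) (lieh : lie_algebra brh).

Let lieA : lie_algebra brA. Proof. by case: quadA. Qed.
Let ndA : nondegenerate fmA. Proof. by case: quadA. Qed.
Let brAP : bilinear_product brA. Proof. by case: lieA. Qed.
Let brhP : bilinear_product brh. Proof. by case: lieh. Qed.
Let brA_inv a b c : fmA (brA a b) c = - fmA b (brA a c).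
Proof. by case: quadA => _ _; apply. Qed.

Local Notation P := (dsum_product brh brA fmA F omega theta Omega).

Lemma muE a b X : mu fmA F a b X = fmA (F X a) b.
Proof.
by apply: linfun_linear => c x y; rewrite linearP add_lfunE scale_lfunE !formE.
Qed.
Lemma nuE X a Y : nu fmA omega X a Y = fmA (omega X Y) a.
Proof. by apply: linfun_linear => c x y; rewrite linearP !formE. Qed.
Lemma rhoE a X Y : rho fmA theta a X Y = fmA (theta X Y) a.
Proof. by apply: linfun_linear => c x y; rewrite linearP !formE. Qed.
Lemma coadE X (al : dual h) Y : coad brh X al Y = - al (brh X Y).
Proof.
apply: linfun_linear => c x y.
by rewrite !(bprodE brhP) linearP opprD scalerN.
Qed.

(** Products are handled through their A-component and the values of their
h^*-component, so that identities in the model become identities in A and in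
the scalars. *)
Definition productA X a Y b : A := theta X Y + brA a b + F X b - F Y a.
Definition productD X a Y b (be : dual h) T : R :=
  Omega Y X T + fmA (F T a) b + fmA (omega X T) b - be (brh X T)
  + fmA (theta Y T) a.

Lemma dsum_ext (u v : dsum h A) : u.1.1 = v.1.1 -> u.1.2 = v.1.2 ->
  (forall T, u.2 T = v.2 T) -> u = v.
Proof.
by case: u v => [[X a] al] [[Y b] be] /= -> -> e; congr (_, _); apply/lfunP.
Qed.

Lemma dsum_productE (u v : dsum h A) :
  [/\ (P u v).1.1 = 0, (P u v).1.2 = productA u.1.1 u.1.2 v.1.1 v.1.2 &
    forall T, (P u v).2 T = productD u.1.1 u.1.2 v.1.1 v.1.2 v.2 T].
Proof.
case: u v => [[X a] al] [[Y b] be]; split=> // T.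
by rewrite /= !add_lfunE muE nuE rhoE coadE.
Qed.

Lemma dsum_product_bilinear : bilinear_product P.
Proof.
split=> [v|u] c x y.
  have [h1 a1 d1] := dsum_productE (c *: x + y) v.
  have [h2 a2 d2] := dsum_productE x v.
  have [h3 a3 d3] := dsum_productE y v.
  apply: dsum_ext => [||T] /=; rewrite ?h1 ?h2 ?h3 ?scaler0 ?addr0 //.
    rewrite a1 a2 a3; apply: (form_inj ndA) => w.
    rewrite /productA /= !linearP !(add_lfunE, scale_lfunE, bprodE brAP) !formE.
    ring.
  rewrite add_lfunE scale_lfunE d1 d2 d3 /productD /= !linearP.
  rewrite !(add_lfunE, scale_lfunE, bprodE brhP) !formE !linearP /GRing.scale /=.
  ring.
have [h1 a1 d1] := dsum_productE u (c *: x + y).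
have [h2 a2 d2] := dsum_productE u x.
have [h3 a3 d3] := dsum_productE u y.
apply: dsum_ext => [||T] /=; rewrite ?h1 ?h2 ?h3 ?scaler0 ?addr0 //.
  rewrite a1 a2 a3; apply: (form_inj ndA) => w.
  rewrite /productA /= !linearP !(add_lfunE, scale_lfunE, bprodE brAP) !formE.
  ring.
rewrite add_lfunE scale_lfunE d1 d2 d3 /productD /= !linearP.
rewrite !(add_lfunE, scale_lfunE, bprodE brhP) !formE /GRing.scale /=.
ring.
Qed.

(** The components of the left Leibniz identity (leibniz_dsumE).  Products have
no component in h, which is why the outer products reduce to few terms. *)
Definition leibnizA X a Y b Z c :=
  brA a (productA Y b Z c) + F X (productA Y b Z c) =
  brA (productA X a Y b) c - F Z (productA X a Y b)
  + (brA b (productA X a Z c) + F Y (productA X a Z c)).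

Definition leibnizD X a Y b Z c (ga : dual h) T :=
  fmA (F T a + omega X T) (productA Y b Z c) - productD Y b Z c ga (brh X T) =
  fmA (F T (productA X a Y b)) c + fmA (theta Z T) (productA X a Y b)
  + (fmA (F T b + omega Y T) (productA X a Z c) - productD X a Z c ga (brh Y T)).

Lemma productA0r X a b : productA X a 0 b = brA a b + F X b.
Proof. by rewrite /productA !linear0 zero_lfunE subr0 add0r. Qed.
Lemma productA0l a Y b : productA 0 a Y b = brA a b - F Y a.
Proof. by rewrite /productA !linear0 !zero_lfunE add0r addr0. Qed.
Lemma productD0r X a b be T :
  productD X a 0 b be T = fmA (F T a + omega X T) b - be (brh X T).
Proof. by rewrite /productD !linear0 !zero_lfunE !formE add0r addr0. Qed.
Lemma productD0l a Y b be T :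
  productD 0 a Y b be T = fmA (F T a) b + fmA (theta Y T) a.
Proof.
rewrite /productD !linear0 !zero_lfunE !formE (bprod0l brhP) linear0.
by rewrite add0r addr0 subr0.
Qed.

Lemma leibniz_dsumE u v w :
  P u (P v w) = P (P u v) w + P v (P u w) <->
  leibnizA u.1.1 u.1.2 v.1.1 v.1.2 w.1.1 w.1.2 /\
  forall T, leibnizD u.1.1 u.1.2 v.1.1 v.1.2 w.1.1 w.1.2 w.2 T.
Proof.
have [vw0 vwA vwD] := dsum_productE v w.
have [uw0 uwA uwD] := dsum_productE u w.
have [uv0 uvA uvD] := dsum_productE u v.
have [l0 lA lD] := dsum_productE u (P v w).
have [m0 mA mD] := dsum_productE (P u v) w.
have [r0 rA rD] := dsum_productE v (P u w).
set t := P u (P v w) in l0 lA lD *.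
set t1 := P (P u v) w in m0 mA mD *.
set t2 := P v (P u w) in r0 rA rD *.
have eqA : (t.1.2 = t1.1.2 + t2.1.2) =
    leibnizA u.1.1 u.1.2 v.1.1 v.1.2 w.1.1 w.1.2.
  by rewrite lA mA rA vw0 uw0 uv0 vwA uwA uvA !productA0r productA0l.
have eqD T : (t.2 T = t1.2 T + t2.2 T) =
    leibnizD u.1.1 u.1.2 v.1.1 v.1.2 w.1.1 w.1.2 w.2 T.
  by rewrite lD mD rD vw0 uw0 uv0 !productD0r productD0l vwA uwA uvA vwD uwD.
split=> [e|[eA eD]].
  rewrite -eqA e; split=> // T; rewrite -eqD e; exact: add_lfunE.
apply: dsum_ext => [||T]; first by rewrite /= l0 m0 r0 addr0.
  by rewrite /= eqA.
by rewrite /= add_lfunE eqD.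
Qed.

(** The form < u . w, v > is skew in (u, v) iff each of its homogeneous parts is:
the part in (X, Y; Z) gives Omega, (X, Y; c) gives omega, (X, a; Z) gives theta
and (a, b; Z) gives F.  The other parts then follow, from the skewness of F and
of the bracket of h and the invariance of the metric of A. *)
Lemma dsum_skewE : (forall u, skew_endo (natural_metric fmA) (P^~ u)) <->
  [/\ forall X, skew_endo fmA (F X),
      forall X Y, omega X Y = - omega Y X,
      forall X Y, theta X Y = - theta Y X &
      forall X Y Z, Omega X Y Z = - Omega X Z Y].
Proof.
have pairE u v w : natural_metric fmA (P u w) v =
    productD u.1.1 u.1.2 w.1.1 w.1.2 w.2 v.1.1
    + fmA (productA u.1.1 u.1.2 w.1.1 w.1.2) v.1.2.
  have [e0 eA eD] := dsum_productE u w.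
  by rewrite /natural_metric e0 eA eD linear0 addr0.
split=> [sk|[Fsk osk tsk Osk] w u v]; last first.
  rewrite [LHS]pairE [X in - X]fmC [X in - X]pairE.
  case: u v w => [[X a] al] [[Y b] be] [[Z c] ga] /=.
  rewrite /productD /productA (lie_skew lieh Y X) linearN /=.
  rewrite (osk Y X) (tsk Z X) (tsk Z Y) (Osk _ Y X) !formE.
  have := brA_inv a c b; have := brA_inv b c a.
  rewrite (lie_skew lieA b a) !formE.
  have := Fsk Y a c; have := Fsk X b c; have := Fsk Z a b.
  have := fmC fmA b (F X c); have := fmC fmA a (F Y c).
  have := fmC fmA a (F Z b); have := fmC fmA c (brA a b).
  lra.
have {}sk X a Y b Z c ga :
    productD X a Z c ga Y + fmA (productA X a Z c) b =
    - (productD Y b Z c ga X + fmA (productA Y b Z c) a).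
  have := sk (Z, c, ga) (X, a, 0) (Y, b, 0).
  by rewrite [X in X = _]pairE [X in - X]fmC [X in - X]pairE.
have zeroE := (bprodE brAP, bprodE brhP, formE, linear0, zero_lfunE).
split=> [Z a b|X Y|X Z|Z X Y].
- have := sk 0 a 0 b Z 0 0; rewrite /productD /productA !zeroE.
  rewrite [fmA (F Z b) a]fmC; lra.
- apply: (form_inj ndA) => c; have := sk X 0 Y 0 0 c 0.
  rewrite /productD /productA !zeroE; lra.
- apply: (form_inj ndA) => a; have := sk X 0 0 a Z 0 0.
  rewrite /productD /productA !zeroE; lra.
- have := sk X 0 Y 0 Z 0 0.
  rewrite /productD /productA !zeroE; lra.
Qed.

Lemma natural_metric_nondegenerate :
  nondegenerate (natural_metric fmA : {symmetric dsum h A}).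
Proof.
apply/nondegenerateP => -[[X a] al] u0.
have {}u0 Y b (be : dual h) : al Y + be X + fmA a b = 0 := u0 (Y, b, be).
have -> : X = 0.
  apply: dual_separates => be.
  by have := u0 0 0 be; rewrite form0r linear0 add0r addr0.
have -> : a = 0.
  apply/(nondegenerateP fmA).1 => // b.
  by have := u0 0 b 0; rewrite zero_lfunE linear0 !add0r.
suff -> : al = 0 by [].
apply/lfunP => Y; have := u0 Y 0 0.
by rewrite form0r !zero_lfunE !addr0.
Qed.

Section SkewData.
Hypotheses (Fsk : forall X, skew_endo fmA (F X))
  (osk : forall X Y, omega X Y = - omega Y X)
  (tsk : forall X Y, theta X Y = - theta Y X)
  (Osk : forall X Y Z, Omega X Y Z = - Omega X Z Y).

Let zeroE := (bprodE brAP, bprodE brhP, formE, linear0, zero_lfunE,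
  subr0, addr0, sub0r, add0r).

(** Each equation is the Leibniz identity at one triple of basic elements:
derivation from (X, a, b), A-component; first equation from (X, a, b),
h^*-component; second from (X, Y, a) and third from (X, Y, Z), A-components;
the last three from (X, Y, a), (X, a, Y) and (X, Y, Z), h^*-components. *)
Lemma leibniz_data_structure :
  (forall u v w, P u (P v w) = P (P u v) w + P v (P u w)) ->
  (forall X, derivation brA (F X)) /\
  structure_equations brh brA fmA F omega theta Omega.
Proof.
move=> leib.
have lA X a Y b Z c : leibnizA X a Y b Z c.
  by have [+ _] := (leibniz_dsumE (X, a, 0) (Y, b, 0) (Z, c, 0)).1 (leib _ _ _).
have lD X a Y b Z c T : leibnizD X a Y b Z c 0 T.
  by have [_] := (leibniz_dsumE (X, a, 0) (Y, b, 0) (Z, c, 0)).1 (leib _ _ _).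
split; first move=> X a b.
  by have := lA X 0 0 a 0 b; rewrite /leibnizA /productA !zeroE.
have eq2 X Y a : brA (theta X Y) a = F X (F Y a) - F Y (F X a).
  by have := lA X 0 Y 0 0 a; rewrite /leibnizA /productA !zeroE => ->; rewrite addrK.
split; last split.
- move=> X Y a; apply: (form_inj ndA) => b.
  have := lD X 0 0 a 0 b Y; rewrite /leibnizD /productA /productD !zeroE.
  have := brA_inv a (omega X Y) b; rewrite (lie_skew lieA a) !formE.
  have := Fsk X (F Y a) b.
  lra.
- exact: eq2.
- move=> X Y Z; have := lA X 0 Y 0 Z 0; rewrite /leibnizA /productA !zeroE => ->.
  by rewrite (tsk Z X) linearN /= addrK addNr.
- move=> X Y Z; apply: (form_inj ndA) => a.
  have := lD X 0 Y 0 0 a Z; rewrite /leibnizD /productA /productD !zeroE.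
  have := Fsk X (omega Y Z) a; have := Fsk Y (omega Z X) a.
  rewrite (osk Z X) !linearN /= !formE; lra.
- move=> X Y Z; apply: (form_inj ndA) => a.
  have := lD X 0 0 a Y 0 Z; rewrite /leibnizD /productA /productD !zeroE.
  have := Fsk X (theta Y Z) a; have := Fsk Y (omega Z X) a.
  have := fmC fmA (F Z a) (theta X Y); have := Fsk Z (theta X Y) a.
  rewrite (osk Z X) !linearN /= !formE; lra.
- move=> X Y Z T.
  have := lD X 0 Y 0 Z 0 T; rewrite /leibnizD /productA /productD !zeroE.
  rewrite /coad2 (lie_skew lieh T X) (lie_skew lieh T Y) (Osk Z (- _)).
  rewrite (tsk Z Y) !formE !dualN; lra.
Qed.

(** Paired with d, the identity is the sum of its homogeneous parts: Jacobi in
(a, b, c), three derivation rules, three instances of the second equation and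
one of the third. *)
Lemma structure_leibnizA : (forall X, derivation brA (F X)) ->
  structure_equations brh brA fmA F omega theta Omega ->
  forall X a Y b Z c, leibnizA X a Y b Z c.
Proof.
move=> der [_ eq2 eq3 _] X a Y b Z c; apply: (form_inj ndA) => d.
have pair x y : x = y -> fmA x d = fmA y d by move->.
have [_ _ /(_ a b c)/pair jac] := lieA.
have /pair eXYc := eq2 X Y c; have /pair eXZb := eq2 X Z b.
have /pair eYZa := eq2 Y Z a; have /pair eXYZ := eq3 X Y Z.
have /pair dXbc := der X b c; have /pair dYac := der Y a c.
have /pair dZab := der Z a b.
move: jac eXYc eXZb eYZa eXYZ dXbc dYac dZab.
rewrite /productA !(bprodE brAP) !linearB !linearD /= !formE.
rewrite (lie_skew lieA c a) (lie_skew lieA c (brA a b)) (lie_skew lieA b (F Z a)).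
rewrite (lie_skew lieA a (theta _ _)) (lie_skew lieA b (theta _ _)).
rewrite (tsk Z X) !linearN /= !(bprodE brAP) !formE.
lra.
Qed.

(** The homogeneous parts are proved one by one, under names listing their
variables.  The parts in (X, b, c) and (a, Y, c) differ only by exchanging the
first two factors, and likewise those in (X, b, Z) and (a, Y, Z).  The part in
(X, Y, gamma) says that ad_X and ad_Y commute, which holds because all double
brackets of h vanish. *)
Lemma structure_leibnizD : two_step brh -> (forall X, derivation brA (F X)) ->
  structure_equations brh brA fmA F omega theta Omega ->
  forall X a Y b Z c ga T, leibnizD X a Y b Z c ga T.
Proof.
move=> nil2 der [eq1 eq2 _ [eq4 eq5 eq6]] X a Y b Z c ga T.
have pair x y d : x = y -> fmA x d = fmA y d by move->.
have abc : fmA (F T a) (brA b c) = fmA (F T (brA a b)) c + fmA (F T b) (brA a c).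
  rewrite der formE (lie_skew lieA (F T a)) formE !brA_inv opprK.
  by rewrite [fmA (F T b) _]fmC -[fmA (brA a c) _]opprK brA_inv; lra.
have Xbc X' b' c' : fmA (omega X' T) (brA b' c') - fmA (F (brh X' T) b') c' =
    fmA (F T (F X' b')) c' + fmA (F T b') (F X' c').
  have := pair _ _ c' (eq1 X' T b'); have := brA_inv b' (omega X' T) c'.
  rewrite (lie_skew lieA b') !formE; have := Fsk X' (F T b') c'; lra.
have abZ : - fmA (F T a) (F Z b) =
    fmA (theta Z T) (brA a b) - fmA (F T b) (F Z a).
  have := pair _ _ b (eq2 Z T a); have := brA_inv a (theta Z T) b.
  rewrite (lie_skew lieA a) !formE.
  have := Fsk Z (F T a) b; have := Fsk T (F Z a) b.
  have := fmC fmA (F Z a) (F T b); lra.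
have XYc : fmA (omega X T) (F Y c) - fmA (omega Y (brh X T)) c =
    fmA (F T (theta X Y)) c + fmA (omega Y T) (F X c)
    - fmA (omega X (brh Y T)) c.
  have := pair _ _ c (eq4 X Y T); have := Fsk X (omega Y T) c.
  have := Fsk Y (omega X T) c.
  rewrite (osk T X) [F Y (- _)]linearN /= !formE; lra.
have aYZ X' a' Y' : - fmA (omega X' T) (F Y' a') - fmA (theta Y' (brh X' T)) a' =
    fmA (theta Y' T) (F X' a') + fmA (F T a') (theta X' Y').
  have := pair _ _ a' (eq5 X' Y' T); have := Fsk X' (theta Y' T) a'.
  have := Fsk Y' (omega X' T) a'; have := Fsk T (theta X' Y') a'.
  have := fmC fmA (theta X' Y') (F T a').
  rewrite (osk T X') [F Y' (- _)]linearN /= !formE; lra.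
have XYZ : fmA (omega X T) (theta Y Z) - Omega Z Y (brh X T) =
    fmA (theta Z T) (theta X Y) + fmA (omega Y T) (theta X Z)
    - Omega Z X (brh Y T).
  have := eq6 X Y Z T; rewrite /coad2 (lie_skew lieh T X) (lie_skew lieh T Y).
  rewrite (Osk Z (- _)) (tsk Z Y) !formE !dualN; lra.
have XYga : ga (brh Y (brh X T)) = ga (brh X (brh Y T)).
  by rewrite (lie_skew lieh Y) (lie_skew lieh X (brh Y T)) !nil2.
have aYc := Xbc Y a c; have {}Xbc := Xbc X b c.
have XbZ := aYZ X b Z; have {}aYZ := aYZ Y a Z.
rewrite /leibnizD /productA /productD.
rewrite !linearB !linearD /= !formE XYga.
lra.
Qed.

End SkewData.

Theorem R_quadratic_dsumP : R_quadratic P (natural_metric fmA) <->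
  [/\ leibniz_data brA fmA F omega theta Omega,
      structure_equations brh brA fmA F omega theta Omega & two_step brh].
Proof.
split=> [[leibP _ /dsum_skewE[Fsk osk tsk Osk]]|[[FP osk tsk Osk] streq nil2]].
  have [der streq] := leibniz_data_structure Fsk osk tsk Osk leibP.2.
  by split=> //; exact: two_step_necessary leibP.
have Fsk X := (FP X).1; have der X := (FP X).2.
split; [split=> [|u v w]| exact: natural_metric_nondegenerate |].
- exact: dsum_product_bilinear.
- apply: (leibniz_dsumE _ _ _).2; split=> [|T]; first exact: structure_leibnizA.
  exact: structure_leibnizD.
- by apply/dsum_skewE; split.
Qed.

End DirectSum.

(** * Riesz isomorphism, sections and transport *)

Section BilinearMaps.
Variables (K : fieldType) (U V W : vectType K) (f : U -> V -> W).

(** Meaningful for bilinear f only, as linfun is for linear functions. *)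
Definition bilfun : 'Hom(U, 'Hom(V, W)) := linfun (fun u => linfun (f u)).

Lemma bilfunE : (forall v, linear (f^~ v)) -> (forall u, linear (f u)) ->
  forall u v, bilfun u v = f u v.
Proof.
move=> fl fr u v; rewrite linfun_linear ?linfun_linear // => c x y.
apply/lfunP => z; rewrite add_lfunE scale_lfunE !linfun_linear //; exact: fl.
Qed.

End BilinearMaps.

Section Riesz.
Variables (R : realType) (V : vectType R) (fm : {symmetric V}).
Hypothesis nd : nondegenerate fm.

Definition flat : 'Hom(V, dual V) := bilfun (fun u v => fm u v : R^o).
Definition sharp : 'Hom(dual V, V) := (flat^-1)%VF.

Lemma flatE u v : flat u v = fm u v.
Proof. by apply: bilfunE => w c x y; rewrite !formE. Qed.

Lemma sharpE al v : fm (sharp al) v = al v.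
Proof.
have ker0 : lker flat == 0%VS.
  apply/lker0P => u w e; apply: (form_inj nd) => x.
  by rewrite -!flatE e.
have imF : limg flat = fullv.
  apply/eqP; rewrite eqEdim subvf /=.
  have := limg_ker_dim flat fullv; rewrite (eqP ker0) capv0 dimv0 add0n => ->.
  by rewrite !dimvf /dim /= muln1.
by rewrite -flatE limg_lfunVK // imF memvf.
Qed.

(** Otherwise a linear form vanishing on U but not at x would exist on the
quotient by U; its Riesz representative is orthogonal to U but not to x. *)
Lemma mem_orthov_orthov (U : {vspace V}) x :
  (forall y, y \in orthov fm U -> fm x y = 0) -> x \in U.
Proof.
move=> xU; have /pivP : piv U x = piv U 0; last by rewrite subr0.
rewrite linear0; apply: dual_separates => al.
pose be : dual V := (al \o linfun (piv U))%VF.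
have beE y : be y = al (piv U y) by rewrite comp_lfunE lfunE.
rewrite -beE -sharpE fmC; apply: xU; apply/perpP => y yU.
rewrite fmC sharpE beE; have -> : piv U y = piv U 0 by apply/pivP; rewrite subr0.
by rewrite !linear0.
Qed.

End Riesz.

Lemma R_quadratic_isomorphic (R : realType) (V W : vectType R)
    (mulV : V -> V -> V) (fmV : {symmetric V})
    (mulW : W -> W -> W) (fmW : {symmetric W}) :
  isomorphic mulV fmV mulW fmW -> R_quadratic mulV fmV -> R_quadratic mulW fmW.
Proof.
move=> [f [[g gK fK] fM fI]] [[mulP leib] nd sk].
have [gl gr] := mulP.
split; first (split; first split).
- by move=> v c x y; rewrite -(fK x) -(fK y) -(fK v) -linearP -!fM gl linearP.
- by move=> v c x y; rewrite -(fK x) -(fK y) -(fK v) -linearP -!fM gr linearP.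
- by move=> u v w; rewrite -(fK u) -(fK v) -(fK w) -!fM leib linearD.
- apply/nondegenerateP => u u0; rewrite -(fK u) (_ : g u = 0) ?linear0 //.
  apply: ((nondegenerateP fmV).1 nd) => v.
  by have := u0 (f v); rewrite -{1}(fK u) fI.
- by move=> u x y; rewrite -(fK u) -(fK x) -(fK y) -!fM !fI sk.
Qed.

Lemma quotv_section (K : fieldType) (V : vectType K) (U : {vspace V}) :
  exists s : 'Hom(quotv U, V), forall q, piv U (s q) = q.
Proof.
exists (linfun (piv U))^-1%VF => q.
rewrite -[piv U _]/(_ (_ q)) -[LHS](lfunE (piv U)) limg_lfunVK //.
by rewrite -(rpvK q) -(lfunE (piv U)) memv_img ?memvf.
Qed.

(** * The core of an R-quadratic Leibniz algebra *)

Section Core.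
Variables (R : realType) (V : vectType R).
Variables (mul : V -> V -> V) (fm : {symmetric V}).
Hypothesis mulP : R_quadratic mul fm.

Local Notation I := (Leib mul).
Local Notation Q := (Leib_perp mul fm).
Local Notation A := (coreA mul fm).
Local Notation h := (coreH mul fm).
Local Notation brA := (coreA_bracket mul fm).
Local Notation brh := (coreH_bracket mul fm).
Local Notation metA := (coreA_metric mul fm).

Let bilP : bilinear_product mul. Proof. by case: mulP => -[]. Qed.
Let leib u v w : mul u (mul v w) = mul (mul u v) w + mul v (mul u w).
Proof. by case: mulP => -[_]. Qed.
Let nd : nondegenerate fm. Proof. by case: mulP. Qed.
Let Rskew u x y : fm (mul x u) y = - fm x (mul y u).
Proof. by case: mulP => _ _; apply. Qed.
Let mulQ u v : mul u v \in Q. Proof. exact: mul_perp mulP u v. Qed.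
Let IQ u : u \in I -> u \in Q.
Proof. by move: u; apply/subvP; exact: Leib_sub_perp mulP. Qed.

Lemma Leib_perp_orth u v : u \in I -> v \in Q -> fm u v = 0.
Proof. by move=> uI /perpP; apply. Qed.

Lemma Leib_perpK u : (forall v, v \in Q -> fm u v = 0) -> u \in I.
Proof. exact: mem_orthov_orthov. Qed.

(** The projection Q -> A, extended to the whole space through vsproj; its
values are meaningful on Q only. *)
Definition classA (w : V) : A := piv _ (vsproj Q w).

Fact classA_linear : linear classA.
Proof. by move=> c x y; rewrite /classA linearP [LHS]linearP. Qed.
HB.instance Definition _ := GRing.isLinear.Build R V A _ classA classA_linear.

Lemma classA_eq0 w : w \in Q -> (classA w = 0) <-> (w \in I).
Proof.
move=> wQ; have -> : (0 : A) = piv _ 0 by rewrite linear0.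
apply: iff_trans (pivP _ _ _) _.
by rewrite subr0 -memv_preim lfunE /= vsprojK.
Qed.

(** Products commute up to sign modulo I, and I is orthogonal to Q and vanishes
in A; hence the next three lemmas. *)
Lemma form_mulC a u v : a \in Q -> fm a (mul u v) = - fm a (mul v u).
Proof.
move=> aQ; apply/eqP; rewrite -addr_eq0 -formDr fmC.
by apply/eqP/Leib_perp_orth => //; exact: Leib_gen.
Qed.

Lemma classA_mulC u v : classA (mul u v) = - classA (mul v u).
Proof.
apply/eqP; rewrite -addr_eq0 -linearD; apply/eqP/classA_eq0; last first.
  exact: Leib_gen.
by rewrite rpredD ?mulQ.
Qed.

Lemma classA_mulrC w u v : classA (mul w (mul u v)) = - classA (mul w (mul v u)).
Proof.
apply/eqP; rewrite -addr_eq0 -linearD -(bprodDr bilP) /=.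
apply/eqP/classA_eq0; first exact: mulQ.
by apply: Leib_mulr mulP _ _ _; exact: Leib_gen.
Qed.

Lemma classA_metric u v : u \in Q -> v \in Q ->
  metA (classA u) (classA v) = fm u v.
Proof. by move=> uQ vQ; rewrite coreA_metricE !vsprojK. Qed.

Lemma classA_bracket u v : u \in Q -> v \in Q ->
  brA (classA u) (classA v) = classA (mul u v).
Proof. by move=> uQ vQ; rewrite coreA_bracketE // !vsprojK. Qed.

Lemma classA_section :
  exists2 r : 'Hom(A, V), (forall a, r a \in Q) & forall a, classA (r a) = a.
Proof.
have [s sK] := quotv_section (linfun (@vsval R V Q) @^-1: I)%VS.
exists (linfun (@vsval R V Q) \o s)%VF => a; rewrite comp_lfunE lfunE.
  exact: subvsP.
by rewrite /classA /= vsvalK sK.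
Qed.

(** The skewness of ad comes from that of right multiplications, since the two
agree up to sign modulo I. *)
Lemma coreA_quadratic : quadratic_lie brA metA.
Proof.
have [r rQ rK] := classA_section.
have brr a b : brA a b = classA (mul (r a) (r b)).
  by rewrite -classA_bracket ?rK.
have brQ a u : u \in Q -> brA a (classA u) = classA (mul (r a) u).
  by move=> uQ; rewrite -classA_bracket ?rK.
split; first split; first split.
- by move=> v c x y; rewrite !brr linearP (bprodPl bilP) linearP.
- by move=> v c x y; rewrite !brr linearP (bprodPr bilP) linearP.
- move=> a; apply/eqP; have := classA_mulC (r a) (r a); rewrite -brr => /eqP.
  rewrite -addr_eq0 -mulr2n -scaler_nat scaler_eq0 => /orP[|//].
  by rewrite Num.Theory.pnatr_eq0.
- move=> a b c; rewrite (brr b c) (brr c a) (brr a b).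
  rewrite !brQ ?mulQ // (classA_mulrC (r b)) (classA_mulC (r c)) leib linearD /=.
  by rewrite addrK subrr.
- apply/nondegenerateP => a a0; rewrite -(rK a); apply/classA_eq0 => //.
  apply: Leib_perpK => v vQ; rewrite -classA_metric ?rK //.
  exact: a0.
- move=> a b c; rewrite -(rK a) -(rK b) -(rK c) !classA_bracket //.
  rewrite [LHS]classA_metric ?mulQ // [X in - X]classA_metric ?mulQ //.
  rewrite Rskew (fmC fm (r b)) Rskew.
  by rewrite (form_mulC (r c)).
Qed.

(** Skew-symmetry of the bracket is R-skewness read through the adjoints; the
Jacobi identity then holds termwise because all double brackets vanish. *)
Lemma coreH_lie : lie_algebra brh.
Proof.
have [s sK] := quotv_section Q.
have brs X Y : brh X Y = - piv Q (adjoint fm (mul (s Y)) (s X)).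
  by rewrite -coreH_bracketE // !sK.
have adjE X Y u : fm u (adjoint fm (mul (s Y)) (s X)) = fm (mul (s Y) u) (s X).
  by rewrite -adjointP //; exact: bilP.2.
have eqQ u v : (forall i, i \in I -> fm i u = fm i v) -> piv Q u = piv Q v.
  by move=> uv; apply/pivP/perpP => i iI; rewrite !formE uv // subrr.
have sk X Y : brh X Y = - brh Y X.
  rewrite !brs opprK -linearN; apply: eqQ => i iI.
  by rewrite formNr !adjE Rskew opprK fmC.
have bl Y : linear (brh^~ Y).
  by move=> c X X'; rewrite !brs !linearP.
split.
- split=> [//|Y c X X']; by rewrite sk bl opprD -scalerN -(sk Y X) -(sk Y X').
- move=> X; apply/eqP; have := sk X X => /eqP.
  rewrite -addr_eq0 -mulr2n -scaler_nat scaler_eq0 => /orP[|//].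
  by rewrite Num.Theory.pnatr_eq0.
- move=> X Y Z; rewrite !(sk _ (brh _ _)) !(coreH_two_step mulP).
  by rewrite oppr0 !addr0.
Qed.

(** The Riesz representative of - alpha o pi is orthogonal to Q, hence lies in I.
The sign is the one that makes the left action of g on I match the coadjoint
action of h. *)
Lemma dual_lift : exists2 d : 'Hom(dual h, V),
  (forall al, d al \in I) & (forall al u, fm (d al) u = - al (piv Q u)).
Proof.
pose f (al : dual h) : V := sharp fm (- (al \o linfun (piv Q))%VF).
have fE al u : fm (f al) u = - al (piv Q u).
  by rewrite sharpE // opp_lfunE comp_lfunE lfunE.
have fl : linear f.
  move=> c x y; apply: (form_inj nd) => u.
  by rewrite !formE !fE add_lfunE scale_lfunE opprD -mulrN.
exists (linfun f) => al; last by move=> u; rewrite linfun_linear.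
rewrite linfun_linear //; apply: Leib_perpK => v vQ; rewrite fE.
have -> : piv Q v = piv Q 0 by apply/pivP; rewrite subr0.
by rewrite !linear0.
Qed.

(** A Witt decomposition.  An arbitrary section of g -> g/Q is first made
orthogonal to r(A), which the nondegenerate metric of A allows, and then made
isotropic by adding half of its Gram form, seen in h^* and lifted to I; the
minus sign in < d(alpha), u > = - alpha(pi u) makes the two halves cancel the
Gram form.  The opposite of the result is a section of - pi. *)
Lemma adapted_sections : exists (s : 'Hom(h, V)) (r : 'Hom(A, V)),
  [/\ forall X, piv Q (s X) = - X,
      forall a, r a \in Q /\ classA (r a) = a,
      forall X a, fm (s X) (r a) = 0 &
      forall X Y, fm (s X) (s Y) = 0].
Proof.
have [r rQ rK] := classA_section.
have [d dI dE] := dual_lift.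
have [s0 s0K] := quotv_section Q.
have [_ ndA _] := coreA_quadratic.
have metr a b : fm (r a) (r b) = metA a b by rewrite -classA_metric ?rK.
have pQ u : u \in Q -> piv Q u = 0.
  by move=> uQ; rewrite -(linear0 (piv Q)); apply/pivP; rewrite subr0.
pose g := bilfun (fun X a => fm (s0 X) (r a) : R^o).
have gE X a : g X a = fm (s0 X) (r a).
  by apply: bilfunE => b c x y; rewrite linearP !formE.
pose s1 : 'Hom(h, V) := s0 - (r \o (sharp metA \o g))%VF.
have s1E X : s1 X = s0 X - r (sharp metA (g X)).
  by rewrite add_lfunE opp_lfunE !comp_lfunE.
have s1r X a : fm (s1 X) (r a) = 0.
  by rewrite s1E !formE metr [metA _ _]sharpE // gE subrr.
have s1K X : piv Q (s1 X) = X by rewrite s1E linearB /= s0K pQ ?subr0.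
pose q := bilfun (fun X Y => fm (s1 X) (s1 Y) : R^o).
have qE X Y : q X Y = fm (s1 X) (s1 Y).
  by apply: bilfunE => b c x y; rewrite linearP !formE.
pose s : 'Hom(h, V) := - (s1 + 2^-1 *: (d \o q)%VF).
have sE X : s X = - (s1 X + 2^-1 *: d (q X)).
  by rewrite opp_lfunE add_lfunE scale_lfunE comp_lfunE.
have s1d X al : fm (s1 X) (d al) = - al X by rewrite fmC dE s1K.
exists s, r; split=> [X|a|X a|X Y].
- by rewrite sE linearN linearD /= s1K pQ ?addr0 // rpredZ // IQ.
- by [].
- by rewrite sE !formE s1r (Leib_perp_orth (dI _) (rQ a)) mulr0 addr0 oppr0.
- rewrite !sE !formE !s1d (Leib_perp_orth (dI _) (IQ (dI _))).
  rewrite dE s1K !qE.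
  have := fmC fm (s1 X) (s1 Y); lra.
Qed.

Section Splitting.
Variables (s : 'Hom(h, V)) (r : 'Hom(A, V)) (d : 'Hom(dual h, V)).
Hypotheses (sK : forall X, piv Q (s X) = - X)
  (rP : forall a, r a \in Q /\ classA (r a) = a)
  (sr : forall X a, fm (s X) (r a) = 0)
  (ss : forall X Y, fm (s X) (s Y) = 0)
  (dI : forall al, d al \in I)
  (dE : forall al u, fm (d al) u = - al (piv Q u)).

Let rQ a : r a \in Q. Proof. by case: (rP a). Qed.
Let rK a : classA (r a) = a. Proof. by case: (rP a). Qed.
Let metr a b : metA a b = fm (r a) (r b).
Proof. by rewrite -(classA_metric (rQ a) (rQ b)) !rK. Qed.
Let metl w a : w \in Q -> metA (classA w) a = fm w (r a).
Proof. by move=> wQ; rewrite -(classA_metric wQ (rQ a)) rK. Qed.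
Let ndA : nondegenerate metA. Proof. by case: coreA_quadratic. Qed.

Let shiftQ v : v + s (piv Q v) \in Q.
Proof. by rewrite -[s _]opprK; apply/pivP; rewrite linearN /= sK opprK. Qed.

(** As s(h) is isotropic and orthogonal to r(A), the products of w with the s(X)
give the h^*-coordinate of w. *)
Definition restr : 'Hom(V, dual h) := bilfun (fun w X => fm w (s X) : R^o).
Definition splitF := bilfun (fun X a => classA (mul (s X) (r a))).
Definition split_theta := bilfun (fun X Y => classA (mul (s X) (s Y))).
Definition split_Omega : 'Hom(h, 'Hom(h, dual h)) :=
  bilfun (fun Y X => restr (mul (s X) (s Y))).
(** The h^*-component of s(X) . r(a) has to be < omega(X, _), a >, so
omega(X, Y) is the Riesz representative of this linear form in a. *)
Definition split_omega_form X Y : dual A :=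
  linfun (fun a => fm (mul (s X) (r a)) (s Y) : R^o).
Definition split_omega := bilfun (fun X Y => sharp metA (split_omega_form X Y)).

Lemma restrE w X : restr w X = fm w (s X).
Proof.
apply: bilfunE => b c x y; first by rewrite !formE.
by rewrite [s _]linearP !formE.
Qed.
Lemma splitFE X a : splitF X a = classA (mul (s X) (r a)).
Proof.
apply: bilfunE => b c x y; rewrite linearP.
  by rewrite (bprodPl bilP) linearP.
by rewrite (bprodPr bilP) linearP.
Qed.
Lemma split_thetaE X Y : split_theta X Y = classA (mul (s X) (s Y)).
Proof.
apply: bilfunE => b c x y; rewrite linearP.
  by rewrite (bprodPl bilP) linearP.
by rewrite (bprodPr bilP) linearP.
Qed.
Lemma split_OmegaE X Y Z : split_Omega Y X Z = fm (mul (s X) (s Y)) (s Z).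
Proof.
rewrite -restrE; congr (fun_of_lfun _ Z).
apply: bilfunE => b c x y; rewrite linearP.
  by rewrite (bprodPr bilP) linearP.
by rewrite (bprodPl bilP) linearP.
Qed.
Lemma split_omegaE X Y a :
  metA (split_omega X Y) a = fm (mul (s X) (r a)) (s Y).
Proof.
have fE X' Y' a' : split_omega_form X' Y' a' = fm (mul (s X') (r a')) (s Y').
  by apply: linfun_linear => c x y; rewrite linearP (bprodPr bilP) !formE.
rewrite [split_omega X Y]bilfunE ?[metA _ _]sharpE // => Z c x y.
  rewrite -linearP; congr (sharp _ _); apply/lfunP => b.
  by rewrite add_lfunE scale_lfunE !fE linearP (bprodPl bilP) !formE.
rewrite -linearP; congr (sharp _ _); apply/lfunP => b.
by rewrite add_lfunE scale_lfunE !fE linearP !formE.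
Qed.

Definition assemble (u : dsum h A) : V := s u.1.1 + r u.1.2 + d u.2.

Lemma assemble_linear : linear assemble.
Proof.
move=> c u v; rewrite /assemble /= !linearP !scalerDr.
by rewrite (addrACA (c *: s _)) (addrACA (c *: s _ + _)).
Qed.

Let fmd w al : w \in Q -> fm w (d al) = 0.
Proof. by move=> wQ; rewrite fmC; apply: Leib_perp_orth. Qed.
Let fmsd X al : fm (s X) (d al) = al X.
Proof. by rewrite fmC dE sK dualN opprK. Qed.

Lemma assemble_metric u v :
  fm (assemble u) (assemble v) = natural_metric metA u v.
Proof.
case: u v => [[X a] al] [[Y b] be]; rewrite /assemble /natural_metric /= !formE.
rewrite ss (fmC fm (r a)) !sr !fmsd !(fmC fm (d al)) !fmsd -metr.
rewrite !fmd ?(IQ (dI _)) //.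
lra.
Qed.

(** w - r(class of w) lies in I, so it is determined by its products with the
s(X), as Q is orthogonal to I. *)
Lemma Leib_perp_split w : w \in Q -> w = r (classA w) + d (restr w).
Proof.
move=> wQ; set w' := w - r (classA w).
have w'I : w' \in I.
  apply/classA_eq0; first by rewrite rpredB.
  by rewrite linearB /= rK subrr.
apply: (addIr (- r (classA w))); rewrite [RHS]addrAC subrr add0r.
apply: (form_inj nd) => v; rewrite dE restrE.
have := Leib_perp_orth w'I (shiftQ v); rewrite formDr [fm w' (s _)]formDl formNl.
rewrite [fm (r _) _]fmC sr oppr0 addr0 => /eqP; rewrite addr_eq0 => /eqP ->.
by [].
Qed.

Lemma assemble_bijective : bijective assemble.
Proof.
have inj : injective assemble.
  move=> u v uv; apply: (form_inj (natural_metric_nondegenerate h coreA_quadratic)).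
  by move=> w; rewrite -[LHS]assemble_metric uv [LHS]assemble_metric.
have surj v : exists u, assemble u == v.
  have vQ := shiftQ v.
  exists (- piv Q v, classA (v + s (piv Q v)), restr (v + s (piv Q v))).
  rewrite /assemble /= -addrA -(Leib_perp_split vQ) linearN /= addrC addrK.
  by [].
exists (fun v => xchoose (surj v)) => [u|v]; last exact/eqP/(xchooseP (surj v)).
by apply: inj; apply/eqP/(xchooseP (surj _)).
Qed.

(** The left-hand side lies in Q, so by Leib_perp_split it suffices to compare
classes in A and products with each s(T).  The terms with left factor in I
vanish.  The products r(a) . s(Y) and r(a) . r(b), which do not enter the
definition of the data, are brought to those that do by exchanging the two
factors modulo I or by moving a right multiplication across the metric. *)
Lemma assemble_product u v :
  mul (assemble u) (assemble v) =
  assemble (dsum_product brh brA metA splitF split_omega split_theta split_Omega u v).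
Proof.
have mulI w i : i \in I -> mul w i \in I by exact: (Leib_mulr mulP).
have Imul i w : i \in I -> mul i w = 0 by exact: (Leib_mul0 mulP).
have quadA := coreA_quadratic; have lieh := coreH_lie.
set P := dsum_product _ _ _ _ _ _ _.
have [P0 PA PD] :=
  dsum_productE brA metA splitF split_omega split_theta split_Omega lieh u v.
rewrite [LHS]Leib_perp_split // /assemble P0 PA linear0 add0r.
case: u v P0 PA PD => [[X a] al] [[Y b] be] _ _ PD /=.
rewrite !(bprodDl bilP) !(bprodDr bilP) !(Imul (d al)) // !addr0.
have Fskew Z c e : fm (mul (s Z) (r c)) (r e) = - fm (r c) (mul (s Z) (r e)).
  by rewrite fmC form_mulC // fmC Rskew opprK form_mulC.
congr (r _ + d _).
  rewrite !linearD /productA /= !splitFE split_thetaE.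
  have cI w : w \in I -> classA w = 0 by move=> wI; apply/classA_eq0; rewrite ?IQ.
  rewrite !(cI (mul _ (d be))) ?mulI // !addr0.
  have -> : classA (mul (r a) (r b)) = brA a b by rewrite -classA_bracket ?rK.
  rewrite (classA_mulC (r a)).
  by rewrite [- _ + _]addrC addrA; congr (_ - _); exact: addrAC.
apply/lfunP => T; rewrite PD /productD /= restrE !formE.
have coadjoint : fm (mul (s X) (d be)) (s T) = - be (brh X T).
  have piX Z : Z = piv Q (- s Z) by rewrite linearN /= sK opprK.
  have -> : brh X T = piv Q (adjoint fm (mul (- s X)) (- s T)).
    by rewrite (lie_skew lieh) {1}(piX T) {1}(piX X) (coreH_bracketE mulP) opprK.
  rewrite -dE -adjointP //; last exact: bilP.2.
  by rewrite (bprodNl bilP) !formE opprK.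
rewrite coadjoint split_OmegaE splitFE split_thetaE split_omegaE !metl //.
rewrite [fm (mul (r a) (s Y)) _]Rskew [fm (mul (r a) (r b)) _]Rskew -Fskew.
rewrite [fm (mul (r a) (d be)) _]Rskew (fmC fm (r a) (mul _ (d be))).
rewrite (Leib_perp_orth _ (rQ a)) ?mulI // form_mulC // opprK (fmC fm (r a)).
lra.
Qed.

End Splitting.

Theorem R_quadratic_core_split :
  exists (F : 'Hom(h, 'End(A))) (omega theta : 'Hom(h, 'Hom(h, A)))
         (Omega : 'Hom(h, 'Hom(h, dual h))),
    isomorphic mul fm (dsum_product brh brA metA F omega theta Omega)
      (natural_metric metA).
Proof.
have [s [r [sK rP sr ss]]] := adapted_sections.
have [d dI dE] := dual_lift.
exists (splitF s r), (split_omega s r), (split_theta s), (split_Omega s).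
pose k := linfun (assemble s r d).
have kE : k =1 assemble s r d by apply: linfun_linear; exact: assemble_linear.
have [g gK Kg] := assemble_bijective sK rP sr ss dI dE.
have kinj : lker k == 0%VS.
  by apply/lker0P => u v; rewrite !kE; exact: can_inj gK _ _.
have kV v : k (k^-1%VF v) = v.
  by rewrite -{1}(Kg v) -kE (lker0_lfunK kinj) kE Kg.
exists k^-1%VF; split.
- by exists k => [v|u]; rewrite ?kV ?(lker0_lfunK kinj).
- move=> u v; apply: (lker0P kinj); rewrite kV -{1}(kV u) -{1}(kV v) !kE.
  exact: assemble_product.
- move=> u v; rewrite -{2}(kV u) -{2}(kV v) !kE.
  by rewrite (assemble_metric sK rP sr ss dI dE).
Qed.

End Core.

Theorem theorem6p1 (R : realType) :
  (forall (g : vectType R) (mul : g -> g -> g) (fm : {symmetric g}%R),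
    R_quadratic mul fm ->
    exists (F : 'Hom(coreH mul fm, 'End(coreA mul fm)))
           (omega theta : 'Hom(coreH mul fm, 'Hom(coreH mul fm, coreA mul fm)))
           (Omega : 'Hom(coreH mul fm, 'Hom(coreH mul fm, dual (coreH mul fm)))),
      [/\ leibniz_data (coreA_bracket mul fm) (coreA_metric mul fm)
            F omega theta Omega,
          isomorphic mul fm
            (dsum_product (coreH_bracket mul fm) (coreA_bracket mul fm)
              (coreA_metric mul fm) F omega theta Omega)
            (natural_metric (coreA_metric mul fm)) &
          structure_equations (coreH_bracket mul fm) (coreA_bracket mul fm)
            (coreA_metric mul fm) F omega theta Omega])
  /\
  (forall (h A : vectType R) (brh : h -> h -> h) (brA : A -> A -> A)
      (fmA : {symmetric A}%R)
      (F : 'Hom(h, 'End(A))) (omega theta : 'Hom(h, 'Hom(h, A)))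
      (Omega : 'Hom(h, 'Hom(h, dual h))),
    quadratic_lie brA fmA -> lie_algebra brh -> two_step brh ->
    leibniz_data brA fmA F omega theta Omega ->
    structure_equations brh brA fmA F omega theta Omega ->
    R_quadratic (dsum_product brh brA fmA F omega theta Omega)
      (natural_metric fmA)).
Proof.
split=> [g mul fm mulP|h A brh brA fmA F omega theta Omega quadA lieh nil2 dat streq].
  have [F [omega [theta [Omega iso]]]] := R_quadratic_core_split mulP.
  exists F, omega, theta, Omega.
  have quadA := coreA_quadratic mulP; have lieh := coreH_lie mulP.
  have := R_quadratic_isomorphic iso mulP.
  by move=> /(R_quadratic_dsumP _ _ _ _ quadA lieh)[dat streq _]; split.
by apply/R_quadratic_dsumP.
Qed.
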